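(* Every Valdivia compact linearly ordered space has weight at most $\aleph_1$.
   Context: Linearly ordered spaces carry the order topology. A compact space $X$ is Valdivia compact if for some $\kappa$ there is an embedding $X\subseteq[0,1]^\kappa$ such that $X=\operatorname{cl}(X\cap\Sigma(\kappa))$, where $\Sigma(\kappa)=\{x\in[0,1]^\kappa: |\{\alpha<\kappa: x(\alpha)\neq 0\}|\le\aleph_0\}$. The weight of a space is the least cardinality of an open base. *)

(* Defs.v *)
From mathcomp Require Import all_boot all_order all_algebra.
From mathcomp Require Import all_classical all_reals all_analysis.
From mathcomp Require Import wochoice.
Import Order.TTheory GRing.Theory Num.Theory.
Import numFieldNormedType.Exports.

Set Implicit Arguments.
Unset Strict Implicit.
Unset Printing Implicit Defensive.

Local Open Scope classical_set_scope.
Local Open Scope card_scope.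
Local Open Scope ring_scope.

(* A pair [(D, r)] codes a countable ordinal when [r] well-orders [D];
   the values of [r] outside [D] are irrelevant. *)
Definition well_ordering : set (set nat * rel nat) :=
  [set P | wo_chain P.2 (mem P.1)].

Definition order_isomorphic (P Q : set nat * rel nat) : Prop :=
  exists2 f : nat -> nat, set_bij P.1 Q.1 f &
    {in P.1 &, forall x y, Q.2 (f x) (f y) = P.2 x y}.

(* The Hartogs construction: [aleph1] is the set of countable ordinals, i.e. of
   order types of well-orderings of subsets of [nat] (finite ones included). *)
Definition aleph1 : set (set (set nat * rel nat)) :=
  [set [set Q | well_ordering Q /\ order_isomorphic P Q] | P in well_ordering].

(* The weight is a minimum of cardinals, so it is bounded by the cardinal of [A]
   exactly when some open base is. *)
Definition weight_le (X : topologicalType) (K : Type) (A : set K) : Prop :=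
  exists2 B : set (set X), B #<= A & basis B.

Definition embedding (X Y : topologicalType) (f : X -> Y) : Prop :=
  injective f /\ [set f @^-1` V | V in open] = open.

(* [{ptws I -> R}] is the Tychonoff power of [R] indexed by [I]; the index type
   [I] plays the role of the cardinal kappa. *)
Definition cube (R : realType) (I : Type) : set {ptws I -> R} :=
  [set x | forall i, 0 <= x i <= 1].

Definition Sigma (R : realType) (I : Type) : set {ptws I -> R} :=
  [set x | cube x /\ countable [set i | x i != 0]].

(* The cube is closed in [{ptws I -> R}], so closures of its subsets may be
   taken there. *)
Definition valdivia_compact (R : realType) (X : topologicalType) : Prop :=
  compact [set: X] /\
  exists (I : Type) (e : X -> {ptws I -> R}),
    [/\ embedding e, range e `<=` @cube R I &
        range e = closure (range e `&` @Sigma R I)].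

(* Main.v *)
(** Let [f i] be the coordinates of [X] in the cube, [supp x] the set of [i] with
    [f i x != 0], and [D] the dense set of points of countable support.
    A closing-off argument yields [E] in [X] and a set [S] of coordinates, both
    of cardinality at most aleph1, such that: [E] contains the extrema; a nonempty
    interval with endpoints in [E] contains a point of [E] in [D]; [S] contains
    [supp e] for [e] in [E] and [D], and uncountably many elements of [supp e]
    for the other [e] in [E]; for [i] in [S], two points with distinct values of
    [f i] are weakly separated by a point of [E], and [E] contains the one-sided
    neighbours of its points witnessing the continuity of [f i].
    Suppose that [a < b] bound a gap of [E]. If the gap contains a point [c] of
    [D], then [a] has support in [S]: clear if [a] is a limit of [E] or in [D],
    and otherwise uncountably many coordinates are nonzero on the whole gap,
    hence at [c]. The same holds for [b], so some [f i] with [i] in [S] separates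
    [a] from [b], which forces [a] and [b] into [E], and then the gap contains a
    point of [E]. Hence [E] is dense; the same reasoning shows that [E] contains
    the endpoints of every jump, so that the open intervals with endpoints in [E]
    form a base. *)
Require Import Defs.
From mathcomp Require Import all_boot all_order all_algebra.
From mathcomp Require Import all_classical all_reals all_analysis.
From mathcomp Require Import wochoice.
Import Order.TTheory GRing.Theory Num.Theory.
Import numFieldNormedType.Exports.

Set Implicit Arguments.
Unset Strict Implicit.
Unset Printing Implicit Defensive.

Local Open Scope classical_set_scope.
Local Open Scope card_scope.

(** * Well-orders and countable ordinals *)

Lemma well_orderP (T : eqType) (r : rel T) : well_order r ->
  [/\ reflexive r, antisymmetric r, transitive r & total r].
Proof.
move=> wor; have woT : wo_chain r predT by move=> A _; exact: wor.
have rr : reflexive r by move=> x; exact: (wo_chain_reflexive woT).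
have ra : antisymmetric r by move=> x y; exact: (wo_chain_antisymmetric woT).
split=> // [y x z rxy ryz|x y]; last exact: (wo_chainW woT).
have [|m [[]]] := wor (mem [:: x; y; z]); first by exists x; rewrite !inE eqxx.
rewrite !inE => mxyz lbm _.
have mx : r m x by apply: lbm; rewrite !inE eqxx.
have my : r m y by apply: lbm; rewrite !inE eqxx orbT.
have mz : r m z by apply: lbm; rewrite !inE eqxx !orbT.
case/or3P: mxyz => /eqP mE; rewrite mE in mx my mz => //.
- by rewrite (ra x y) // rxy.
- by rewrite -(ra y z) // ryz.
Qed.

Lemma well_order_min (T : eqType) (r : rel T) (A : set T) :
  well_order r -> A !=set0 -> exists2 m, A m & forall x, A x -> r m x.
Proof.
move=> wor [x Ax]; have [|m [[Am lbm] _]] := wor (mem A).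
  by exists x; exact/mem_set.
by exists m => [|y Ay]; [exact/set_mem|apply: lbm; exact/mem_set].
Qed.

Lemma well_order_lt_wf (T : eqType) (r : rel T) :
  well_order r -> well_founded (fun x y => ~~ r y x).
Proof.
move=> wor x; apply: contrapT => nx.
have [|m nm mmin] := well_order_min (A := [set y | ~ Acc (fun x y => ~~ r y x) y]) wor.
  by exists x.
apply: nm; constructor => y /negP rmy; apply: contrapT => ny; apply: rmy.
exact: mmin.
Qed.

(* An isomorphism from a segment of [r] onto a shorter one would be a
   self-embedding of the longer segment, hence inflationary. *)
Lemma well_order_seg_rigid (T : eqType) (r : rel T) (a b : T) (g : T -> T) :
  well_order r -> (forall x, r x b -> r (g x) a) ->
  (forall x y, r x b -> r y b -> r (g x) (g y) = r x y) ->
  r b a.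
Proof.
move=> wor gba gr; have [rr ra rt rtot] := well_orderP wor.
case/orP: (rtot b a) => // rab.
suff infl x : r x b -> r x (g x) by apply: rt (infl b (rr b)) (gba b (rr b)).
apply: contraPP => nx rxb.
have [|m [rmb nm] mmin] :=
  well_order_min (A := [set x | r x b /\ ~ r x (g x)]) wor; first by exists x.
have rgm : r (g m) m by case/orP: (rtot (g m) m).
have rgb : r (g m) b := rt _ _ _ (gba _ rmb) rab.
apply: nm; rewrite -gr //; apply: contrapT => ngm; apply: (ngm).
by rewrite gr //; apply: mmin.
Qed.

(** Each point is sent to the order type of its initial segment, a countable ordinal; rigidity of
    segments makes this map injective. *)
Lemma countable_segs_card_le (T : eqType) (r : rel T) : well_order r ->
  (forall x, countable [set y | r y x]) -> [set: T] #<= aleph1.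
Proof.
move=> wor segc; have [rr ra rt rtot] := well_orderP wor.
(* [c.1] numbers the segment below [x] and [c.2] decodes it; pulling [r] back along [c.2] copies the
   segment into [nat]. Numbers that code nothing decode to the filler [x]. *)
have code x : exists c : (T -> nat) * (nat -> T),
    forall y, r y x -> c.2 (c.1 y) = y.
  have /countable_injP[f finj] := segc x.
  have /choice[g gP] n : exists y, forall z, r z x -> f z = n -> z = y.
    have [[y [ryx <-]]|no] := pselect (exists y, r y x /\ f y = n).
      by exists y => z rzx; apply: finj; rewrite inE.
    by exists x => z rzx fz; case: no; exists z.
  by exists (f, g) => y ryx /=; rewrite -(gP (f y) y).
have [c cK] := choice code.
pose P x : set nat * rel nat :=
  ((c x).1 @` [set y | r y x], fun m n => r ((c x).2 m) ((c x).2 n)).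
have Pwo x : well_ordering (P x).
  apply: antisymmetric_wo_chain => [m n|A sA [n An]].
    rewrite !inE => -[y ryx <-] [z rzx <-] /=.
    by rewrite !cK // => /ra ->.
  have [|y [m Am <-] mmin] :=
    well_order_min (A := (c x).2 @` [set m | m \in A]) wor.
    by exists ((c x).2 n); exists n.
  by exists m; split=> // k Ak; apply: mmin; exists k.
pose F x := [set Q | well_ordering Q /\ order_isomorphic (P x) Q].
have Fle x y : F x = F y -> r y x.
  move=> Fxy; have : F x (P x).
    split=> //; exists id => //; split=> //.
    by move=> z; exists z.
  rewrite Fxy => -[_ [f [fP _ _] fr]].
  (* Encoding, then [f], then decoding maps the segment below [y] into the one below [x] and
     preserves the order. *)
  apply: (@well_order_seg_rigid _ _ _ _ (fun z => (c x).2 (f ((c y).1 z)))) => //.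
    move=> z rzy; have /fP[u rux <-] : (P y).1 ((c y).1 z) by exists z.
    by rewrite cK.
  move=> u v ruy rvy.
  have := fr ((c y).1 u) ((c y).1 v); rewrite !inE /= => ->.
  - by rewrite !cK.
  - by exists u.
  - by exists v.
have Finj : {in [set: T] &, injective F}.
  by move=> x y _ _ Fxy; apply: ra; rewrite !Fle.
rewrite -(card_le_eql (inj_card_eq Finj)).
by apply: subset_card_le => _ [x _ <-]; exists (P x).
Qed.

(** A copy of omega_1, cut out of a well-order of [set nat] as the points with countable segments.
    If these were countable, either they exhaust [set nat], against Cantor, or the least other point
    has a countable segment after all. *)
Lemma uncountable_well_order : exists (W : eqType) (le : rel W),
  [/\ well_order le, forall w, countable [set v | le v w] &
      ~ countable [set: W]].
Proof.
have [le wole] := well_ordering_principle (set nat).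
have [lr la lt ltot] := well_orderP wole.
pose short x := `[<countable [set y | le y x]>].
pose W := {x | short x}; pose leW : rel W := relpre val le.
have segW (w : W) : countable [set v | leW v w].
  case: w => w /= sw; have /countable_injP[f finj] := asboolW sw.
  apply/countable_injP; exists (f \o val) => u v.
  by rewrite !inE => uw vw /finj/val_inj; apply; rewrite inE.
exists W, leW; split=> //.
- apply: antisymmetric_well_order => [u v /la/val_inj //|A [w Aw]].
  have [|_ [m Am <-] mmin] :=
    well_order_min (A := val @` [set w | w \in A]) wole.
    by exists (val w); exists w.
  by exists m; split=> // v Av; apply: mmin; exists v.
- move=> /countable_injP[f finj].
  have cshort : countable [set x | short x].
    apply/countable_injP.
    exists (fun x => oapp f 0 (insub x : option W)) => x y.
    rewrite !inE => sx sy; rewrite !insubT /= => /finj.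
    by rewrite !inE => /(_ Logic.I Logic.I)/(congr1 val).
  have [all_short|] := pselect (forall x, short x).
    have : countable [set: set nat].
      by apply: sub_countable cshort; apply: subset_card_le => x _; exact: all_short.
    move=> /countable_injP[g ginj].
    pose D := [set n | exists2 A, g A = n & ~ A n].
    have [DD|nDD] := pselect (D (g D)).
      by case: (DD) => A /ginj -> //; rewrite inE.
    by apply: (nDD); exists D.
  move=> /existsNP[x nx].
  have [|m nm mmin] := well_order_min (A := [set x | ~ short x]) wole.
    by exists x.
  apply: nm; apply/asboolP.
  have : countable ([set x | short x] `|` [set m]).
    rewrite -bigcup2E; apply: bigcup_countable => // -[|[|n]] _ //=.
  apply: sub_countable.
  apply: subset_card_le => y /= lym.
  have [sy|nsy] := pselect (short y); [by left|right].
  by apply: la; rewrite lym mmin.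
Qed.

(** * Sets of cardinality at most aleph1 *)

Section SmallSets.
Variables (W : eqType) (le : rel W).
Hypotheses (wole : well_order le) (segc : forall w, countable [set v | le v w]).
Hypothesis Wunc : ~ countable [set: W].

(* Cardinality at most aleph1, phrased through a rank function so that closure
   under unions needs no cardinal arithmetic. *)
Definition small T (A : set T) :=
  exists h : T -> W, forall w, countable (A `&` [set x | le (h x) w]).

Let nonemptyW : [set: W] !=set0.
Proof. by apply/set0P/eqP => W0; apply: Wunc; rewrite W0. Qed.

(** A point of the union gets a rank bounding both the rank of some index and its own rank in that
    member. Ranks up to [w] then involve countably many members and a countable part of each. *)
Lemma small_bigcup I T (D : set I) (F : I -> set T) :
  small D -> (forall i, D i -> small (F i)) -> small (\bigcup_(i in D) F i).
Proof.
have [lr la lt ltot] := well_orderP wole.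
have [w0 _] := nonemptyW.
move=> [hD hDc] Fs.
have /choice[hF hFc] i : exists h : T -> W,
    D i -> forall w, countable (F i `&` [set x | le (h x) w]).
  have [Di|nDi] := pselect (D i); last by exists (fun=> w0).
  by have [h hc] := Fs i Di; exists h.
have /choice[h hP] x : exists w, (\bigcup_(i in D) F i) x ->
    exists i, [/\ D i, F i x, le (hD i) w & le (hF i x) w].
  have [[i Di Fix]|nx] := pselect ((\bigcup_(i in D) F i) x); last by exists w0.
  have [le1|le2] := orP (ltot (hD i) (hF i x)).
    by exists (hF i x) => _; exists i.
  by exists (hD i) => _; exists i.
exists h => w.
have : countable (\bigcup_(i in D `&` [set i | le (hD i) w])
    (F i `&` [set x | le (hF i x) w])).
  by apply: bigcup_countable => // i [Di _]; exact: hFc.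
apply: sub_countable; apply: subset_card_le => x [/hP[i [Di Fix Dw Fw]]] /= hw.
by exists i; split=> //=; [exact: lt hw|exact: lt hw].
Qed.

Lemma countable_small T (A : set T) : countable A -> small A.
Proof.
move=> Ac; have [w _] := nonemptyW.
exists (fun=> w) => v; apply: sub_countable Ac.
by apply: subset_card_le => x [].
Qed.

Lemma small_image T U (f : T -> U) (A : set T) : small A -> small (f @` A).
Proof.
move=> As; rewrite (_ : _ @` _ = \bigcup_(x in A) [set f x]).
  by apply: small_bigcup => // x _; apply: countable_small.
by apply/seteqP; split=> [_ [x Ax <-]|_ [x Ax ->]]; [exists x|exists x].
Qed.

Lemma small_setU T (A B : set T) : small A -> small B -> small (A `|` B).
Proof.
move=> As Bs; rewrite -bigcup2E; apply: small_bigcup.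
  exact: countable_small.
by move=> [|[|n]] _ //=; exact: countable_small.
Qed.

(** Since [G] takes only two arguments, countably many rounds suffice: any two points of the union
    already lie in a common stage. *)
Lemma small_closure T (A0 : set T) (G : T -> T -> set T) :
  small A0 -> (forall x y, small (G x y)) ->
  exists A, [/\ small A, A0 `<=` A & forall x y, A x -> A y -> G x y `<=` A].
Proof.
move=> A0s Gs.
pose step A := A `|` \bigcup_(x in A) \bigcup_(y in A) G x y.
pose An n := iter n step A0.
have Anle m n : (m <= n)%N -> An m `<=` An n.
  move=> /subnK <-; elim: (n - m)%N => // k IH x /IH.
  by rewrite addSn; left.
exists (\bigcup_n An n); split.
- apply: small_bigcup => [|n _]; first exact: countable_small.
  elim: n => // n IH; apply: small_setU => //.
  by apply: small_bigcup => // x _; exact: small_bigcup.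
- by move=> x A0x; exists 0%N.
- move=> x y [m _ Amx] [n _ Any] z Gz; exists (maxn m n).+1 => //=.
  right; exists x; first exact: Anle (leq_maxl m n) _ Amx.
  by exists y => //; exact: Anle (leq_maxr m n) _ Any.
Qed.

(** Transfinite recursion along [W] picks a point of [U] different from all earlier ones, which
    exists because segments are countable and [U] is not. The injective image of [W] so obtained is
    the required set. *)
Lemma small_uncountable_subset T (U : set T) : ~ countable U ->
  exists J, [/\ J `<=` U, small J & ~ countable J].
Proof.
move=> Uunc; have [lr la lt ltot] := well_orderP wole.
have [t0 Ut0] : U !=set0 by apply/set0P/eqP => U0; apply: Uunc; rewrite U0.
have /choice[pick pickP] (A : set T) : exists t, countable A -> U t /\ ~ A t.
  have [Ac|] := pselect (countable A); last by exists t0.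
  suff [t] : exists t, U t /\ ~ A t by exists t.
  apply: contrapT => /forallNP noU; apply: Uunc.
  apply: sub_countable Ac; apply: subset_card_le => t Ut.
  by apply: contrapT => nAt; apply: (noU t).
pose lt_wf := well_order_lt_wf wole.
pose F w (rec : forall v, ~~ le w v -> T) :=
  pick [set t | exists v (vw : ~~ le w v), t = rec v vw].
pose g := Fix lt_wf (fun=> T) F.
have gE w : g w = pick (g @` [set v | ~~ le w v]).
  rewrite /g Fix_eq => [|x f f' ff']; last first.
    by congr pick; apply/seteqP; split=> t [v [vx ->]]; exists v, vx; rewrite ff'.
  congr pick; apply/seteqP; split=> t.
    by move=> [v [vw ->]]; exists v.
  by move=> [v vw <-]; exists v, vw.
have gc w : countable (g @` [set v | ~~ le w v]).
  apply: (card_le_trans (card_image_le _ _)).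
  apply: sub_countable (segc w); apply: subset_card_le => v /= nwv.
  by have := ltot w v; rewrite (negbTE nwv).
have ginj : {in [set: W] &, injective g}.
  suff gne v w : ~~ le w v -> g v <> g w.
    move=> v w _ _ gvw; apply: la.
    by apply/andP; split; apply/negPn/negP => /gne; rewrite gvw.
  move=> vw gvw; have [_] := pickP _ (gc w); apply; rewrite -gE -gvw.
  by exists v.
exists (range g); split.
- by move=> _ [w _ <-]; rewrite gE; case: (pickP _ (gc w)).
- apply: small_image; exists id => w; apply: sub_countable (segc w).
  by apply: subset_card_le => v [].
- by apply: contra_not Wunc; rewrite /countable (card_le_eql (inj_card_eq ginj)).
Qed.

(** A point is coded by its rank together with its number among the points of at most that rank. The
    lexicographic order on [W * nat] is a well-order with countable segments. *)
Lemma small_card_le T (A : set T) : small A -> A #<= aleph1.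
Proof.
move=> [h hc]; have [lr la lt ltot] := well_orderP wole.
have /choice[k kinj] w : exists k : T -> nat,
    {in A `&` [set x | le (h x) w] &, injective k}.
  by have /countable_injP := hc w.
pose r : rel (W * nat) := fun p q =>
  if p.1 == q.1 then (p.2 <= q.2)%N else le p.1 q.1.
have rwo : well_order r.
  apply: antisymmetric_well_order => [[v m] [w n]|B [p Bp]].
    rewrite /r /= (eq_sym w); case: eqP => [-> mn|vw /la/vw //].
    by congr pair; apply/eqP; rewrite eqn_leq.
  have [|_ [q Bq <-] wmin] :=
    well_order_min (A := fst @` [set q | q \in B]) wole.
    by exists p.1; exists p.
  have exn : exists n, (q.1, n) \in B by exists q.2; case: (q) Bq.
  exists (q.1, ex_minn exn); case: ex_minnP => n Bn nmin; split=> // -[w m] Bwm.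
  rewrite /r /=; case: eqP => [E|_]; last by apply: wmin; exists (w, m).
  by apply: nmin; rewrite E.
have rseg p : countable [set q | r q p].
  have : countable ([set v | le v p.1] `*` [set: nat]) by exact: countableX.
  apply: sub_countable; apply: subset_card_le => q /=; rewrite /r.
  by case: eqP => [->|_ ?].
pose f x := (h x, k (h x) x).
have finj : {in A &, injective f}.
  move=> x y; rewrite !inE => Ax Ay [hxy]; rewrite hxy.
  by apply: kinj; rewrite inE; split=> //=; rewrite hxy.
rewrite -(card_le_eql (inj_card_eq finj)).
exact: card_le_trans (card_leT _) (countable_segs_card_le rwo rseg).
Qed.

End SmallSets.

(** * Order topology, compactness and continuous real functions *)

Section OrderTopology.
Local Open Scope order_scope.
Context {d : Order.disp_t} {X : orderTopologicalType d}.
Implicit Types (a b c p q t u v x y : X) (A : set X).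

Lemma nbhs_right_itv p q (U : set X) : nbhs p U -> p < q ->
  exists2 t, p < t & forall x, p < x < t -> U x.
Proof.
rewrite itv_nbhsE => -[[l r] [+ +] sU] pq.
case: r sU => [[] r|[]] sU; rewrite ?itv_boundlr;
  [|by case: l {sU} => [[]|[]]| by case: l {sU} => [[]|[]]|].
- move=> _ /andP[lp pr]; exists r; first by rewrite bnd_simp in pr.
  move=> x /andP[px xr]; apply: sU; rewrite /= itv_boundlr; apply/andP; split.
    by apply: le_trans lp _; rewrite bnd_simp ltW.
  by rewrite bnd_simp.
(* The interval is unbounded on the right, so any point above [p] will do, and [q] is one. *)
- move=> _ /andP[lp _]; exists q => // x /andP[px _]; apply: sU.
  rewrite /= itv_boundlr; apply/andP; split=> //.
  by apply: le_trans lp _; rewrite bnd_simp ltW.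
Qed.

Lemma nbhs_left_itv p q (U : set X) : nbhs p U -> q < p ->
  exists2 t, t < p & forall x, t < x < p -> U x.
Proof.
rewrite itv_nbhsE => -[[l r] [+ +] sU] pq.
case: l sU => [[] l|[]] sU; rewrite ?itv_boundlr;
  [by case: r {sU} => [[]|[]]| |  |by case: r {sU} => [[]|[]]].
- move=> _ /andP[lp pr]; exists l; first by rewrite bnd_simp in lp.
  move=> x /andP[lx xp]; apply: sU; rewrite /= itv_boundlr; apply/andP; split.
    by rewrite bnd_simp.
  by apply: le_trans pr; rewrite bnd_simp ltW.
- move=> _ /andP[_ pr]; exists q => // x /andP[_ xp]; apply: sU.
  rewrite /= itv_boundlr; apply/andP; split=> //.
  by apply: le_trans pr; rewrite bnd_simp ltW.
Qed.

Hypothesis cX : compact [set: X].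

(** The supremum is a cluster point of the filter of tails of [A], which compactness provides. *)
Lemma compact_order_sup A : A !=set0 ->
  exists s, (forall a, A a -> a <= s) /\
            (forall u, u < s -> exists2 a, A a & u < a).
Proof.
move=> [a0 Aa0].
pose F := filter_from A (fun a => A `&` [set x | a <= x]).
have FF : ProperFilter F.
  apply: filter_from_proper => [|a Aa]; last first.
    by exists a; split=> /=.
  apply: filter_from_filter => [|a b Aa Ab]; first by exists a0.
  have [ab|ba] := leP a b; [exists b|exists a] => // x [Ax /= bx].
  - by split; split=> //=; exact: le_trans bx.
  - by split; split=> //=; exact: le_trans (ltW ba) bx.
have [|s [_ cs]] := cX FF; first by exists a0.
exists s; split=> [a Aa|u us].
  rewrite leNgt; apply/negP => sa.
  have [||x [[_ ax]]] := cs (A `&` [set x | a <= x]) `]-oo, a[%classic.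
  - by exists a.
  - by apply: open_nbhs_nbhs; split; [exact: lray_open|rewrite set_itvE].
  by rewrite set_itvE /= ltNge ax.
have [||x [[Ax _]]] := cs (A `&` [set x | a0 <= x]) `]u, +oo[%classic.
- by exists a0.
- by apply: open_nbhs_nbhs; split; [exact: rray_open|rewrite set_itvE].
by rewrite set_itvE => ux; exists x.
Qed.

Lemma compact_order_inf A : A !=set0 ->
  exists s, (forall a, A a -> s <= a) /\
            (forall u, s < u -> exists2 a, A a & a < u).
Proof.
move=> [a0 Aa0].
pose F := filter_from A (fun a => A `&` [set x | x <= a]).
have FF : ProperFilter F.
  apply: filter_from_proper => [|a Aa]; last first.
    by exists a; split=> /=.
  apply: filter_from_filter => [|a b Aa Ab]; first by exists a0.
  have [ab|ba] := leP a b; [exists a|exists b] => // x [Ax /= xb].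
  - by split; split=> //=; exact: le_trans ab.
  - by split; split=> //=; exact: le_trans (ltW ba).
have [|s [_ cs]] := cX FF; first by exists a0.
exists s; split=> [a Aa|u us].
  rewrite leNgt; apply/negP => sa.
  have [||x [[_ xa]]] := cs (A `&` [set x | x <= a]) `]a, +oo[%classic.
  - by exists a.
  - by apply: open_nbhs_nbhs; split; [exact: rray_open|rewrite set_itvE].
  by rewrite set_itvE /= ltNge xa.
have [||x [[Ax _]]] := cs (A `&` [set x | x <= a0]) `]-oo, u[%classic.
- by exists a0.
- by apply: open_nbhs_nbhs; split; [exact: lray_open|rewrite set_itvE].
by rewrite set_itvE => ux; exists x.
Qed.

Section RealFunction.
Context {R : realType} {f : X -> R}.
Hypothesis cf : continuous f.

Lemma continuous_neq_nbhs p (r : R) : f p != r -> nbhs p [set x | f x != r].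
Proof.
move=> fpr; suff /cf : nbhs (f p) [set y | y != r] by [].
apply: open_nbhs_nbhs; split=> //.
Qed.

Lemma continuous_dist_nbhs p (e : R) :
  (0 < e)%R -> nbhs p [set x | (`|f x - f p| < e)%R].
Proof. by move=> e0; have /cvgr_distC_lt := @cf p; exact. Qed.

Let small_invn (e : R) : (0 < e)%R -> exists n, (n.+1%:R^-1 < e)%R.
Proof. by move/ltr_add_invr => [n]; rewrite add0r => ?; exists n. Qed.

(** One [t] per precision serves all values: [r] is avoided as soon as the precision is finer than
    its distance to [f p]. *)
Lemma right_neq_points p : exists2 T : set X, countable T &
  forall q r, p < q -> r != f p ->
    exists t, [/\ T t, p < t & forall x, p < x < t -> f x != r].
Proof.
have /choice[T TP] n : exists t, forall q, p < q ->
    p < t /\ forall x, p < x < t -> (`|f x - f p| < n.+1%:R^-1)%R.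
  have [[q pq]|noq] := pselect (exists q, p < q); last first.
    by exists p => q pq; case: noq; exists q.
  have e0 : (0 < n.+1%:R^-1 :> R)%R by rewrite invr_gt0 ltr0n.
  have [t pt tP] := nbhs_right_itv (continuous_dist_nbhs p e0) pq.
  by exists t.
exists (range T); first exact: (card_le_trans (card_image_le _ _)).
move=> q r pq rfp; have [|n nP] := @small_invn `|r - f p|%R.
  by rewrite normr_gt0 subr_eq0.
have [pT Tf] := TP n _ pq; exists (T n); split=> // x /Tf.
by apply: contraTN => /eqP ->; rewrite -leNgt ltW.
Qed.

Lemma left_neq_points p : exists2 T : set X, countable T &
  forall q r, q < p -> r != f p ->
    exists t, [/\ T t, t < p & forall x, t < x < p -> f x != r].
Proof.
have /choice[T TP] n : exists t, forall q, q < p ->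
    t < p /\ forall x, t < x < p -> (`|f x - f p| < n.+1%:R^-1)%R.
  have [[q pq]|noq] := pselect (exists q, q < p); last first.
    by exists p => q pq; case: noq; exists q.
  have e0 : (0 < n.+1%:R^-1 :> R)%R by rewrite invr_gt0 ltr0n.
  have [t pt tP] := nbhs_left_itv (continuous_dist_nbhs p e0) pq.
  by exists t.
exists (range T); first exact: (card_le_trans (card_image_le _ _)).
move=> q r pq rfp; have [|n nP] := @small_invn `|r - f p|%R.
  by rewrite normr_gt0 subr_eq0.
have [pT Tf] := TP n _ pq; exists (T n); split=> // x /Tf.
by apply: contraTN => /eqP ->; rewrite -leNgt ltW.
Qed.

(* For each precision, the endpoints of a finite cover by intervals on which
   [f] oscillates little. *)
Lemma separating_points : exists2 E : set X, countable E &
  forall x y, x < y -> f x != f y -> exists2 e, E e & x <= e <= y.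
Proof.
have /choice[E EP] n : exists E : set X, finite_set E /\ forall x y, x < y ->
    (n.+1%:R^-1 <= `|f x - f y|)%R -> exists2 e, E e & x <= e <= y.
  (* Eventually along [F] means for all finite sets containing a fixed finite one, so the
     near-covering form of compactness yields one finite set good for every [x]. *)
  pose F := filter_from (@finite_set X) (fun E0 => [set E | finite_set E /\ E0 `<=` E]).
  have FF : ProperFilter F.
    apply: filter_from_proper => [|E0 E0f]; last by exists E0; split.
    apply: filter_from_filter => [|E1 E2 E1f E2f]; first by exists set0; exact: finite_set0.
    exists (E1 `|` E2); first by rewrite /= finite_setU.
    by move=> E [Ef E12]; split; split=> // x xE; apply: E12; [left|right].
  pose P (E : set X) x := forall y, x < y ->
    (n.+1%:R^-1 <= `|f x - f y|)%R -> exists2 e, E e & x <= e <= y.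
  have /compact_near_coveringP/(_ _ F P) cov := cX.
  have [|E0 E0f EP] := cov _; last first.
    by exists E0; split=> // x y; have /(_ x Logic.I y) := EP E0 (conj E0f (@subset_refl _ _)).
  move=> p _; have e0 : (0 < n.+1%:R^-1 / 2 :> R)%R by rewrite divr_gt0.
  have := continuous_dist_nbhs p e0.
  rewrite {1}itv_nbhsE => -[i [iop ip] iU].
  pose E0 := [set e | i.2 = BLeft e].
  have E0f : finite_set E0.
    rewrite /E0; move: i.2 => [b e|b].
      by apply: (sub_finite_set _ (finite_set1 e)) => y [_ ->].
    by apply: (sub_finite_set _ (finite_set0 X)) => y.
  exists ([set` i], [set E | finite_set E /\ E0 `<=` E]).
    split; first by rewrite itv_nbhsE; exists i.
    by exists E0.
  move=> [x E] /= [xi [_ E0E]] y xy xye.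
  (* Values at two points of [i] differ by less than the precision, so [y] lies beyond the right end
     of [i], and that end is the point sought. *)
  have yi : y \notin i.
    apply: contraTN xye => yi; rewrite -ltNge.
    rewrite [ltRHS]splitr (le_lt_trans (ler_distD (f p) _ _)) //.
    by rewrite ltrD ?iU // distrC iU.
  have {}E0E e : i.2 = BLeft e -> E e by exact: E0E.
  case: i {ip iU E0f} @E0 iop xi yi E0E => l r _.
  have ly : (l <= BLeft x)%O -> (l <= BLeft y)%O.
    by move=> /le_trans; apply; rewrite bnd_simp ltW.
  case: r => [[] r|[]] /=; rewrite ?itv_boundlr.
  - move=> _ /andP[/ly -> /=]; rewrite !bnd_simp => xr; rewrite -leNgt => ry Er.
    by exists r; [exact: Er|rewrite ltW].
  - by case: l {ly} => [[]|[]].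
  - by rewrite andbF.
  - by move=> _ /andP[/ly ->].
exists (\bigcup_n E n).
  by apply: bigcup_countable => // n _; apply: finite_set_countable; have [] := EP n.
move=> x y xy fxy; have [|n nP] := @small_invn `|f x - f y|%R.
  by rewrite normr_gt0 subr_eq0.
have [e Ee xey] := (EP n).2 _ _ xy (ltW nP).
by exists e => //; exists n.
Qed.

End RealFunction.
End OrderTopology.

(** * Weight of a compact ordered space with densely many points of countable support *)

Section Weight.
Local Open Scope order_scope.
Context {R : realType} {d : Order.disp_t} {X : orderTopologicalType d}.
Context {I : Type} (f : I -> X -> R).
Hypothesis cX : compact [set: X].
Hypothesis cf : forall i, continuous (f i).
Hypothesis finj : forall x y, (forall i, f i x = f i y) -> x = y.

Let supp x : set I := [set i | f i x != 0%R].
Let D : set X := [set x | countable (supp x)].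
Hypothesis Ddense : dense D.

Implicit Types (a b c e t u v x y : X) (i : I).

Let D_itv u v x : u < x < v -> exists2 c, D c & u < c < v.
Proof.
move=> uxv; have [|c [+ Dc]] := Ddense _ (itv_open u v).
  by exists x; rewrite /= in_itv.
by rewrite /= in_itv; exists c.
Qed.

Section Skeleton.
Variables (E : set X) (S : set I).
Hypothesis E_min : exists2 m, E m & forall x, m <= x.
Hypothesis E_max : exists2 m, E m & forall x, x <= m.
Hypothesis E_pick : forall e e' x, E e -> E e' -> e < x < e' ->
  exists c, [/\ E c, D c & e < c < e'].
Hypothesis S_D : forall e, E e -> D e -> supp e `<=` S.
Hypothesis S_nD : forall e, E e -> ~ D e ->
  exists J, [/\ J `<=` S, J `<=` supp e & ~ countable J].
Hypothesis E_sep : forall i x y, S i -> x < y -> f i x != f i y ->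
  exists2 e, E e & x <= e <= y.
Hypothesis E_right : forall e i q r, E e -> S i -> e < q -> r != f i e ->
  exists t, [/\ E t, e < t & forall x, e < x < t -> f i x != r].
Hypothesis E_left : forall e i q r, E e -> S i -> q < e -> r != f i e ->
  exists t, [/\ E t, t < e & forall x, t < x < e -> f i x != r].

(** A coordinate that is nonzero at [a] stays nonzero just to the left. Three points of [E] there
    enclose a point of [E] in [D], whose support lies in [S]; the middle one witnesses that the
    interval is nonempty. *)
Lemma supp_left_limit a q : q < a ->
  (forall u, u < a -> exists2 e, E e & u < e < a) -> supp a `<=` S.
Proof.
move=> qa lim i ai.
have [t ta tP] := nbhs_left_itv (continuous_neq_nbhs (cf (i := i)) ai) qa.
have [e1 Ee1 /andP[te1 e1a]] := lim _ ta.
have [e2 Ee2 /andP[e12 e2a]] := lim _ e1a.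
have [e3 Ee3 /andP[e23 e3a]] := lim _ e2a.
have [|c [Ec Dc /andP[e1c ce3]]] := E_pick (x := e2) Ee1 Ee3; first by rewrite e12.
apply: (S_D Ec Dc); apply: tP.
by rewrite (lt_trans te1 e1c) (lt_trans ce3 e3a).
Qed.

Lemma supp_right_limit a q : a < q ->
  (forall u, a < u -> exists2 e, E e & a < e < u) -> supp a `<=` S.
Proof.
move=> aq lim i ai.
have [t at_ tP] := nbhs_right_itv (continuous_neq_nbhs (cf (i := i)) ai) aq.
have [e1 Ee1 /andP[ae1 e1t]] := lim _ at_.
have [e2 Ee2 /andP[ae2 e21]] := lim _ ae1.
have [e3 Ee3 /andP[ae3 e32]] := lim _ ae2.
have [|c [Ec Dc /andP[e3c ce1]]] := E_pick (x := e2) Ee3 Ee1; first by rewrite e32.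
apply: (S_D Ec Dc); apply: tP.
by rewrite (lt_trans ae3 e3c) (lt_trans ce1 e1t).
Qed.

(** Some coordinate in [S] separates [a] from [b], so [E_sep] puts one of them in [E]. Its neighbour
    avoiding the value at the other endpoint can lie neither inside the gap nor beyond it, hence
    equals that endpoint. *)
Lemma gap_endpoints a b : a < b -> (forall x, a < x < b -> ~ E x) ->
  supp a `<=` S -> supp b `<=` S -> E a /\ E b.
Proof.
move=> ab noE aS bS.
have [i Si fab] : exists2 i, S i & f i a != f i b.
  apply: contrapT => nofi.
  have fE i : f i a = f i b.
    apply: contrapT => /eqP fab; apply: nofi; exists i => //.
    have [fa0|/aS//] := eqVneq (f i a) 0%R.
    by apply: bS; rewrite /supp /= -fa0 eq_sym.
  by move: ab; rewrite (finj fE) ltxx.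
have [e Ee /andP[]] := E_sep Si ab fab.
rewrite le_eqVlt => /orP[/eqP ae _|ae].
  rewrite -{}ae {e} in Ee; split=> //.
  have [|t [Et at_ tP]] := @E_right a i b (f i b) Ee Si ab; first by rewrite eq_sym.
  case: (ltgtP t b) => [tb|bt|<- //].
    by case: (noE t); rewrite ?at_.
  by have := tP b; rewrite ab bt eqxx => /(_ isT).
rewrite le_eqVlt => /orP[/eqP eb|eb]; last by case: (noE e); rewrite ?ae.
rewrite {}eb {e ae} in Ee; split=> //.
have [t [Et tb tP]] := E_left Ee Si ab fab.
case: (ltgtP t a) => [ta|at_|<- //].
  by have := tP a; rewrite ab ta eqxx => /(_ isT).
by case: (noE t); rewrite ?at_.
Qed.

Lemma skeleton_dense u v x : u < x < v -> exists2 e, E e & u < e < v.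
Proof.
move=> /D_itv[c Dc /andP[uc cv]]; apply: contrapT => noe.
have uvE e : E e -> e <= u \/ v <= e.
  move=> Ee; case: (leP e u) => [|ue]; [by left|case: (leP v e) => [|ev]].
    by right.
  by case: noe; exists e; rewrite // ue.
have [m Em mmin] := E_min; have [M EM Mmax] := E_max.
(* [a] and [b] will be the ends of the gap of [E] around [c]; the extrema in [E] make the two sets
   nonempty. *)
have [|a [aub alub]] := compact_order_sup cX (A := E `&` [set e | e <= u]).
  by exists m; split=> //=.
have [|b [blb bglb]] := compact_order_inf cX (A := E `&` [set e | v <= e]).
  by exists M; split=> //=.
have au : a <= u.
  by rewrite leNgt; apply/negP => /alub[e [_ /= eu]]; rewrite ltNge eu.
have vb : v <= b.
  by rewrite leNgt; apply/negP => /bglb[e [_ /= ve]]; rewrite ltNge ve.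
have ac : a < c := le_lt_trans au uc.
have cb : c < b := lt_le_trans cv vb.
have ab : a < b := lt_trans ac cb.
have noE e : a < e < b -> ~ E e.
  move=> /andP[ae eb] Ee; case: (uvE e Ee) => [eu|ve].
    by move: ae; rewrite ltNge aub.
  by move: eb; rewrite ltNge blb.
have aS : supp a `<=` S.
  have [Ea|nEa] := pselect (E a); last first.
    apply: (@supp_left_limit a m) => [|w wa].
      by rewrite lt_neqAle mmin andbT; apply/eqP => ma; apply: nEa; rewrite -ma.
    have [e [Ee /= eu] we] := alub _ wa; exists e => //; rewrite we /=.
    by rewrite lt_neqAle aub // andbT; apply/eqP => ea; apply: nEa; rewrite -ea.
  have [|/(S_nD Ea)[J [JS Ja Junc]]] := pselect (D a); first exact: S_D.
  (* For [i] in [J], the neighbour [t] of [a] cannot fall inside the gap, so [f i] is nonzero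
     throughout it and [i] is in the countable support of [c]. *)
  exfalso; apply: Junc; apply: sub_countable Dc; apply: subset_card_le => i Ji.
  have [|t [Et at_ tP]] := @E_right a i b 0%R Ea (JS _ Ji) ab.
    by rewrite eq_sym; exact: Ja.
  apply: tP; rewrite ac; apply: lt_le_trans cb _; rewrite leNgt; apply/negP => tb.
  by apply: (noE t); rewrite ?at_.
have bS : supp b `<=` S.
  have [Eb|nEb] := pselect (E b); last first.
    apply: (@supp_right_limit b M) => [|w bw].
      by rewrite lt_neqAle Mmax andbT; apply/eqP => bM; apply: nEb; rewrite bM.
    have [e [Ee /= ve] ew] := bglb _ bw; exists e => //; rewrite ew andbT.
    by rewrite lt_neqAle blb // andbT; apply/eqP => be; apply: nEb; rewrite be.
  have [|/(S_nD Eb)[J [JS Jb Junc]]] := pselect (D b); first exact: S_D.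
  exfalso; apply: Junc; apply: sub_countable Dc; apply: subset_card_le => i Ji.
  have [|t [Et tb tP]] := @E_left b i a 0%R Eb (JS _ Ji) ab.
    by rewrite eq_sym; exact: Jb.
  apply: tP; rewrite cb andbT; apply: le_lt_trans _ ac; rewrite leNgt.
  by apply/negP => at_; apply: (noE t); rewrite ?at_.
have [Ea Eb] := gap_endpoints ab noE aS bS.
by have [|e [Ee _]] := E_pick (x := c) Ea Eb; [rewrite ac|move=> /noE].
Qed.

Lemma skeleton_jump x y : x < y -> (forall z, ~ x < z < y) -> E x /\ E y.
Proof.
move=> xy jump; have [m Em mmin] := E_min; have [M EM Mmax] := E_max.
have noE z : x < z < y -> ~ E z by move/jump.
(* Each of [x], [y] is isolated, hence in [E] and [D] by density, or a limit. *)
apply: gap_endpoints => //.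
- have [[u ux]|nou] := pselect (exists u, u < x); last first.
    (* Here [x] is the minimum, so it is in [E] by [E_min]; the open ray below [y] is [x] alone,
       which puts [x] in [D]. *)
    have xmin z : x <= z by rewrite leNgt; apply/negP => zx; apply: nou; exists z.
    have [|c [/= + Dc]] := Ddense _ (lray_open y).
      by exists x; rewrite /= in_itv.
    rewrite in_itv /= => cy; have cx : c = x.
      apply/eqP; rewrite eq_le xmin andbT leNgt; apply/negP => xc.
      by apply: (jump c); rewrite xc.
    have mx : m = x by apply/eqP; rewrite eq_le mmin xmin.
    by apply: S_D; [rewrite -mx|rewrite -cx].
  have [[w wx wP]|now] := pselect (exists2 w, w < x & forall z, ~ w < z < x).
    have only z : w < z < y -> z = x.
      move=> /andP[wz zy]; case: (ltgtP z x) => // zx.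
        by case: (wP z); rewrite wz.
      by case: (jump z); rewrite zx.
    have [|e Ee /only ex] := @skeleton_dense w y x; first by rewrite wx.
    have [|c Dc /only cx] := @D_itv w y x; first by rewrite wx.
    by apply: S_D; [rewrite -ex|rewrite -cx].
  apply: (supp_left_limit ux) => w wx.
  have [z wzx] : exists z, w < z < x.
    by apply: contrapT => /forallNP noz; apply: now; exists w.
  exact: skeleton_dense wzx.
- have [[u yu]|nou] := pselect (exists u, y < u); last first.
    have ymax z : z <= y by rewrite leNgt; apply/negP => yz; apply: nou; exists z.
    have [|c [/= + Dc]] := Ddense _ (rray_open x).
      by exists y; rewrite /= in_itv /= andbT.
    rewrite in_itv /= andbT => xc; have cy : c = y.
      apply/eqP; rewrite eq_le ymax /= leNgt; apply/negP => cy.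
      by apply: (jump c); rewrite xc.
    have My : M = y by apply/eqP; rewrite eq_le Mmax ymax.
    by apply: S_D; [rewrite -My|rewrite -cy].
  have [[w yw wP]|now] := pselect (exists2 w, y < w & forall z, ~ y < z < w).
    have only z : x < z < w -> z = y.
      move=> /andP[xz zw]; case: (ltgtP z y) => // zy.
        by case: (jump z); rewrite xz.
      by case: (wP z); rewrite zy.
    have [|e Ee /only ey] := @skeleton_dense x w y; first by rewrite xy.
    have [|c Dc /only cy] := @D_itv x w y; first by rewrite xy.
    by apply: S_D; [rewrite -ey|rewrite -cy].
  apply: (supp_right_limit yu) => w yw.
  have [z yzw] : exists z, y < z < w.
    by apply: contrapT => /forallNP noz; apply: now; exists w.
  exact: skeleton_dense yzw.
Qed.

(** Each endpoint of an interval around [x] moves to a point of [E] weakly nearer to [x]: density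
    gives one if some point lies strictly between, and otherwise the endpoint and [x] form a
    jump. *)
Lemma skeleton_basis : basis (\bigcup_(e in E) \bigcup_(e' in E)
  [set `]e, e'[%classic; `]-oo, e'[%classic; `]e, +oo[%classic; setT]).
Proof.
split=> [U [e _ [e' _ [[[->|->]|->]|->]]]|x U].
- exact: itv_open.
- exact: lray_open.
- exact: rray_open.
- exact: openT.
have left_end u : u < x -> exists2 e, E e & u <= e < x.
  move=> ux; have [[z uzx]|noz] := pselect (exists z, u < z < x).
    have [e Ee /andP[ue ex]] := skeleton_dense uzx.
    by exists e => //; rewrite (ltW ue).
  have [|Eu _] := @skeleton_jump u x ux; first by move=> z uzx; apply: noz; exists z.
  by exists u; rewrite // lexx.
have right_end u : x < u -> exists2 e, E e & x < e <= u.
  move=> xu; have [[z xzu]|noz] := pselect (exists z, x < z < u).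
    have [e Ee /andP[xe eu]] := skeleton_dense xzu.
    by exists e => //; rewrite (ltW eu) andbT.
  have [|_ Eu] := @skeleton_jump x u xu; first by move=> z xzu; apply: noz; exists z.
  by exists u; rewrite // lexx andbT.
have [m Em _] := E_min.
rewrite {1}itv_nbhsE => -[[l r] [iop xi] iU].
have := xi; rewrite /= itv_boundlr => /andP[lx xr].
have [l' [l'E ll' l'x]] : exists l' : itv_bound X,
    [/\ l' = -oo%O \/ (exists2 e, E e & l' = BRight e), l <= l' & l' <= BLeft x].
  case: l lx iop {iU xi} => [[] u|[]] // ux.
  - move=> _; rewrite bnd_simp in ux; have [e Ee /andP[ue ex]] := left_end _ ux.
    by exists (BRight e); split; rewrite ?bnd_simp //; right; exists e.
  - by move=> _; exists -oo%O; split=> //; left.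
have [r' [r'E rr' xr']] : exists r' : itv_bound X,
    [/\ r' = +oo%O \/ (exists2 e, E e & r' = BLeft e), r' <= r & BRight x <= r'].
  case: r xr iop {iU xi} => [[] u|[]] // xu.
  - move=> _; rewrite bnd_simp in xu; have [e Ee /andP[xe eu]] := right_end _ xu.
    by exists (BLeft e); split; rewrite ?bnd_simp //; right; exists e.
  - by case: l {lx ll'} => [[]|[]].
  - by move=> _; exists +oo%O; split=> //; left.
exists [set` Interval l' r']; last first.
  move=> y; rewrite /= itv_boundlr => /andP[l'y yr']; apply: iU.
  by rewrite /= itv_boundlr (le_trans ll' l'y) (le_trans yr' rr').
split; last by rewrite /= itv_boundlr l'x.
case: l'E r'E => [->|[e Ee ->]] [->|[e' Ee' ->]].
(* [m] fills the index of an unbounded side. *)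
- by exists m => //; exists m => //; right; rewrite set_itvE.
- by exists m => //; exists e' => //; left; left; right.
- by exists e => //; exists m => //; left; right.
- by exists e => //; exists e' => //; left; left; left.
Qed.

End Skeleton.

(** * The closing-off construction *)

Lemma weight_le_aleph1 : weight_le X aleph1.
Proof.
have [[x0 _]|noX] := pselect (exists x : X, True); last first.
  exists set0; first exact: card_ge0.
  by split=> // x; case: noX; exists x.
have [|m [mmin _]] := compact_order_inf cX (A := [set: X]); first by exists x0.
have [|M [Mmax _]] := compact_order_sup cX (A := [set: X]); first by exists x0.
have [W [le [wole segc Wunc]]] := uncountable_well_order.
pose small_countable := @countable_small W le Wunc.
have /choice[pick pickP] (p : X * X) : exists c,
    forall x, p.1 < x < p.2 -> D c /\ p.1 < c < p.2.
  have [[x /D_itv[c Dc pcp]]|nox] := pselect (exists x, p.1 < x < p.2).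
    by exists c.
  by exists p.1 => x px; case: nox; exists x.
(* A countable support can enter [S] whole; an uncountable one may be too large, so only a small
   uncountable part is kept. *)
have /choice[J JP] e : exists J, [/\ small le J, J `<=` supp e,
    D e -> supp e `<=` J & ~ D e -> ~ countable J].
  have [De|nDe] := pselect (D e).
    by exists (supp e); split=> // [|_ //]; exact: small_countable.
  by have [J [Je Js Junc]] := small_uncountable_subset wole segc Wunc nDe; exists J.
have /choice[Q QP] i : exists Q : set X, countable Q /\
    forall x y, x < y -> f i x != f i y -> exists2 e, Q e & x <= e <= y.
  by have [Q Qc QP] := separating_points cX (cf (i := i)); exists Q.
have /choice[Tr TrP] (p : X * I) : exists T : set X, countable T /\
    forall q r, p.1 < q -> r != f p.2 p.1 ->
      exists t, [/\ T t, p.1 < t & forall x, p.1 < x < t -> f p.2 x != r].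
  by have [T Tc TP] := right_neq_points (cf (i := p.2)) p.1; exists T.
have /choice[Tl TlP] (p : X * I) : exists T : set X, countable T /\
    forall q r, q < p.1 -> r != f p.2 p.1 ->
      exists t, [/\ T t, t < p.1 & forall x, t < x < p.1 -> f p.2 x != r].
  by have [T Tc TP] := left_neq_points (cf (i := p.2)) p.1; exists T.
(* Points and coordinates are closed off together in a disjoint sum. Choices in intervals depend on
   two points, neighbours on a point and a coordinate, so a binary operation covers everything. *)
pose G (z z' : X + I) : set (X + I) := match z, z' with
  | inl e, inl e' => [set inl (pick (e, e'))] `|` inr @` J e
  | inl e, inr i => inl @` (Tr (e, i) `|` Tl (e, i))
  | inr i, _ => inl @` Q i
  end.
have Gs z z' : small le (G z z').
  case: z z' => [e|i] [e'|i'] /=.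
  - apply: small_setU => //; first exact: small_countable.
    by apply: small_image => //; have [] := JP e.
  - apply: small_image => //; apply: small_setU => //; apply: small_countable.
      by have [] := TrP (e, i').
    by have [] := TlP (e, i').
  - by apply: small_image => //; apply: small_countable; have [] := QP i.
  - by apply: small_image => //; apply: small_countable; have [] := QP i.
have M0s : small le [set (inl m : X + I); inl M].
  by apply: small_countable; apply: finite_set_countable; exact: finite_set2.
have [A [As A0 AG]] := small_closure wole Wunc M0s Gs.
pose E := [set e | A (inl e)]; pose S := [set i | A (inr i)].
have Es : small le E.
  have [h hc] := As; exists (h \o inl) => w.
  have /countable_injP[k kinj] := hc w; apply/countable_injP.
  exists (k \o inl) => x y; rewrite !inE => Ax Ay /kinj; rewrite !inE.
  by move=> /(_ Ax Ay) [].
exists (\bigcup_(e in E) \bigcup_(e' in E)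
  [set `]e, e'[%classic; `]-oo, e'[%classic; `]e, +oo[%classic; setT]).
  apply: (small_card_le wole segc).
  apply: small_bigcup => // e _; apply: small_bigcup => // e' _.
  by apply: small_countable; apply: finite_set_countable; exact: finite_set4.
apply: (@skeleton_basis E S).
- by exists m => [|x]; [apply: A0; left|exact: mmin].
- by exists M => [|x]; [apply: A0; right|exact: Mmax].
- move=> e e' x Ee Ee' exe'; have [Dc ece'] := pickP (e, e') x exe'.
  by exists (pick (e, e')); split=> //; apply: (AG _ _ Ee Ee'); left.
- move=> e Ee De i ei; apply: (AG _ _ Ee Ee); right; exists i => //.
  by have [_ _ + _] := JP e; apply.
- move=> e Ee nDe; have [_ Je _ Junc] := JP e; exists (J e); split=> //.
    by move=> i Ji; apply: (AG _ _ Ee Ee); right; exists i.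
  exact: Junc.
- move=> i x y Si xy fxy; have [e Qe xey] := (QP i).2 _ _ xy fxy.
  by exists e => //; apply: (AG _ _ Si Si); exists e.
- move=> e i q r Ee Si eq rf; have [t [Tt et tP]] := (TrP (e, i)).2 _ _ eq rf.
  by exists t; split=> //; apply: (AG _ _ Ee Si); exists t => //; left.
- move=> e i q r Ee Si eq rf; have [t [Tt et tP]] := (TlP (e, i)).2 _ _ eq rf.
  by exists t; split=> //; apply: (AG _ _ Ee Si); exists t => //; right.
Qed.

End Weight.

(** * Transfer along the embedding into the cube *)

Theorem proposition5p5 (R : realType) (d : Order.disp_t)
    (X : orderTopologicalType d) (hX : valdivia_compact R X) :
  weight_le X aleph1.
Proof.
have [cX [I [e [[einj eop] eI eD]]]] := hX.
have ce : continuous e.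
  by apply/continuousP => V oV; rewrite -eop; exists V.
have cf i : continuous (fun x => e x i).
  move=> x; apply: (@continuous_comp _ _ _ e (fun g : {ptws I -> R} => g i)).
    exact: ce.
  exact: (@proj_continuous {classic I} (fun=> R) i).
apply: (weight_le_aleph1 cX cf) => [x y exy|U [x Ux]].
  by apply: einj; apply/funext.
rewrite -eop => -[V oV VU].
(* Density of the points of countable support: a neighbourhood of [e x] meets the image of such a
   point. *)
have : closure (range e `&` @Sigma R I) (e x) by rewrite -eD; exists x.
have eVx : V (e x) by rewrite -VU in Ux.
move=> /(_ V (open_nbhs_nbhs (conj oV eVx))) [_ [[[y _ <-] [_ yc]] Vy]].
by exists y; split; rewrite -?VU.
Qed.
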